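(* Let $\mathcal{H}$ be a reproducing kernel Hilbert space on a non-empty set $X$ with non-vanishing kernel $K$. Let $\varphi:X\to\mathbb{C}$ be a function. Then $\|\varphi\|_{\mathrm{Mult}(\mathcal{H}),2}\le1$ if and only if $\varphi$ is constant of modulus at most $1$ or $\varphi$ maps $X$ into $\mathbb{D}$ and satisfies $$\delta(\varphi(z),\varphi(w))\le\delta_{\mathcal{H}}(z,w)$$ for all $z,w\in X$.
   Context: $\mathbb{D}$ is the open unit disc. $K$ non-vanishing means $K(z,w)\neq0$ for all $z,w\in X$. The pseudo-metric $\delta_{\mathcal{H}}$ on $X$ is $$\delta_{\mathcal{H}}(z,w)=\Big(1-\frac{|K(z,w)|^2}{K(z,z)K(w,w)}\Big)^{1/2},$$ and $\delta$ is the pseudohyperbolic metric on $\mathbb{D}$, $\delta(z,w)=\Big|\frac{z-w}{1-\overline{w}z}\Big|$. The $2$-point multiplier norm of $\varphi:X\to\mathbb{C}$ is $$\|\varphi\|_{\mathrm{Mult}(\mathcal{H}),2}=\inf\{C\ge0:[K(x_i,x_j)(C^2-\varphi(x_i)\overline{\varphi(x_j)})]_{i,j=1}^2\text{ is positive semi-definite for all }x_1,x_2\in X\}$$ (the points need not be distinct; the value is $+\infty$ if no such $C$ exists). *)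

(* Defs.v *)
From HB Require Import structures.
From mathcomp Require Import all_boot all_order all_algebra.
From mathcomp Require Export complex.
From mathcomp Require Import all_classical all_reals all_analysis.

Set Implicit Arguments.
Unset Strict Implicit.
Unset Printing Implicit Defensive.

Import Order.TTheory GRing.Theory Num.Theory.
Import numFieldNormedType.Exports.
Import Normc.

Local Open Scope classical_set_scope.
Local Open Scope ring_scope.

Section Hilbert.
Variables (R : realType) (H : lmodType R[i]) (form : {dot H for Num.conj}).

(* Library forms of type [{dot H for Num.conj}] are linear in the first
   argument and conjugate-linear in the second. *)
Definition hnorm (f : H) : R := Num.sqrt (complex.Re (form f f)).

Definition hcauchy (u : nat -> H) : Prop :=
  forall e : R, 0 < e -> exists N : nat, forall m n : nat,
    (N <= m)%N -> (N <= n)%N -> hnorm (u m - u n) < e.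

Definition hconverges (u : nat -> H) (l : H) : Prop :=
  hnorm (u n - l) @[n --> \oo] --> (0 : R).

Definition hcomplete : Prop :=
  forall u : nat -> H, hcauchy u -> exists l : H, hconverges u l.

End Hilbert.

(* A Hilbert space of functions [X -> R[i]]: the injective linear map
   [rkhs_fun] identifies the vectors with the functions they stand for, so
   that the vector operations are the pointwise ones. *)
Structure rkhs (R : realType) (X : Type) := RKHS {
  rkhs_space :> lmodType R[i];
  rkhs_dot : {dot rkhs_space for Num.conj};
  rkhs_fun : {linear rkhs_space -> (X -> (R[i])^o)};
  rkhs_fun_inj : injective rkhs_fun;
  rkhs_complete : hcomplete rkhs_dot;
  rkhs_eval_bounded : forall x : X, exists M : R, forall f : rkhs_space,
    normc (rkhs_fun f x : R[i]) <= M * hnorm rkhs_dot f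
}.

Section Kernel.
Variables (R : realType) (X : Type).
Implicit Types (K : X -> X -> R[i]) (phi : X -> R[i]) (x z w : X).

(* [K(., w)] is the element of [H] representing evaluation at [w]; this
   determines [K] uniquely. *)
Definition reproducing_kernel (H : rkhs R X) K : Prop :=
  forall w, exists k : H,
    (forall z, rkhs_fun H k z = K z w) /\
    (forall f : H, rkhs_dot H f k = rkhs_fun H f w).

Definition non_vanishing K : Prop := forall z w, K z w != 0.

(* [K z z] and [K w w] are real for a reproducing kernel, hence the real
   parts. *)
Definition kernel_dist K z w : R :=
  Num.sqrt (1 - normc (K z w) ^+ 2 /
                (complex.Re (K z z) * complex.Re (K w w))).

Definition pseudohyp_dist (a b : R[i]) : R :=
  normc ((a - b) / (1 - Num.conj b * a)).

Definition unit_disc : set R[i] := [set a | normc a < 1].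

(* In the order of [R[i]], [0 <= a] says that [a] is real and nonnegative;
   in particular a positive semi-definite matrix is Hermitian. *)
Definition psd n (A : 'M[R[i]]_n) : Prop :=
  forall v : 'cV[R[i]]_n, 0 <= ((map_mx Num.conj v)^T *m A *m v) 0 0.

(* The infimum is taken in [\bar R], where [ereal_inf set0 = +oo]. *)
Definition mult_norm2 K phi : \bar R :=
  ereal_inf [set C%:E | C in [set C : R | 0 <= C /\
    forall x : 'I_2 -> X,
      psd (\matrix_(i < 2, j < 2)
             (K (x i) (x j) *
              (real_complex R (C ^+ 2) - phi (x i) * Num.conj (phi (x j)))))]].

End Kernel.

(* Main.v *)
Require Import Defs.
From mathcomp Require Import all_boot all_order all_algebra.
From mathcomp Require Import all_classical all_reals all_analysis.
From mathcomp Require Import ring lra.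
Import Order.TTheory GRing.Theory Num.Theory.
Import Normc.
Local Open Scope ring_scope.

(** The statement [mult_norm2 K phi <= 1] can be decided at the single
    constant [C = 1].  The matrix at level [C ^+ 2] depends affinely on
    [C ^+ 2], with slope the Gram matrix of [K], which is positive
    semi-definite; so admissible constants are upward closed
    ([psd_add_scale]), and letting [C] decrease to [1] loses nothing
    ([psd_limit]).  Hence [mult_norm2_le1P].

    A Hermitian 2 x 2 matrix is positive semi-definite exactly when its diagonal
    and its determinant are nonnegative ([psd2P]).  With [C = 1] and
    [a = phi z], [b = phi w], this reads [|a| <= 1], [|b| <= 1] and
<<
    |K z w|^2 |1 - b^* a|^2 <= K z z * K w w * (1 - |a|^2) * (1 - |b|^2),
>>
    which is [pick_condition].  When [a] and [b] lie in the open disc, the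
    identity
<<
    |1 - b^* a|^2 - |a - b|^2 = (1 - |a|^2) * (1 - |b|^2)
>>
    turns it into the contraction inequality between [pseudohyp_dist] and
    [kernel_dist] ([kernel_dist_pick]).  If instead [|a| = 1] for some point
    [z], the right-hand side vanishes; as [K z w] does not, [b^* a = 1] for
    every [w], that is [b = a], and [phi] is constant.  Conversely, for a
    constant of modulus at most [1] the condition is the Cauchy-Schwarz
    inequality for [K] multiplied by [(1 - |a|^2) ^+ 2]. *)

(** * Complex modulus and conjugation *)

Section ComplexModulus.
Context {R : realType}.
Implicit Types a b z : R[i].

Lemma mul_conjC_normc z : z * z^* = (normc z ^+ 2)%:C%C.
Proof. by rewrite -normCK rmorphXn. Qed.

Lemma conjC_real (p : R) : (p%:C%C)^* = p%:C%C.
Proof. by apply/eqP; rewrite eq_complex /= oppr0 !eqxx. Qed.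

Lemma normc_ge0 z : 0 <= normc z.
Proof. by case: z => x y; exact: sqrtr_ge0. Qed.

Lemma normc_conj_eq a b : normc a = 1 -> a * b^* = 1 -> b = a.
Proof.
move=> a1 ab1.
have aa1 : a * a^* = 1 by rewrite mul_conjC_normc a1 expr1n.
apply: (can_inj conjCK).
have a0 : a != 0.
  by apply: contra_eq_neq ab1 => ->; rewrite mul0r eq_sym oner_neq0.
by apply: (mulfI a0); rewrite ab1.
Qed.

(** The identity [1 - delta(a, b)^2 = (1 - |a|^2)(1 - |b|^2) / |1 - b^* a|^2]
    for the pseudohyperbolic metric, with denominators cleared so that it holds
    on the whole plane. *)
Lemma disc_identity a b :
  normc (a - b) ^+ 2 =
  normc (1 - b^* * a) ^+ 2 - (1 - normc a ^+ 2) * (1 - normc b ^+ 2).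
Proof.
case: a b => [a1 a2] [b1 b2] /=.
by rewrite !sqr_sqrtr ?addr_ge0 ?sqr_ge0//; simpc => /=; ring.
Qed.

End ComplexModulus.

(** * Positive semi-definite matrices *)

Section PositiveSemidefinite.
Context {R : realType}.
Implicit Types (p q : R) (b : R[i]).

Definition qform {n} (A : 'M[R[i]]_n) (v : 'cV[R[i]]_n) : R[i] :=
  ((map_mx Num.conj v)^T *m A *m v) 0 0.

Lemma qformDZ n (A B : 'M[R[i]]_n) p v :
  qform (A + p%:C%C *: B) v = qform A v + p%:C%C * qform B v.
Proof.
rewrite /qform mulmxDr mulmxDl -scalemxAr -scalemxAl mxE.
by congr +%R; rewrite mxE.
Qed.

Lemma psd_add_scale n (A B : 'M[R[i]]_n) p :
  0 <= p -> psd A -> psd B -> psd (A + p%:C%C *: B).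
Proof.
move=> p0 psdA psdB v; rewrite -/(qform _ v) qformDZ.
by rewrite addr_ge0 ?psdA// mulr_ge0 ?ler0c ?psdB.
Qed.

(** For fixed [v] the hypothesis reads [0 <= a + p * b] with [b >= 0] real; let
    [p] tend to [0].  As the order of [R[i]] also requires the left-hand side
    to be real, real and imaginary parts are treated separately. *)
Lemma psd_limit n (A B : 'M[R[i]]_n) :
  (forall p, 0 < p -> psd (A + p%:C%C *: B)) -> psd B -> psd A.
Proof.
move=> psdAB psdB v; rewrite -/(qform A v).
have QAB p : 0 < p -> 0 <= qform A v + p%:C%C * qform B v.
  by move=> /psdAB/(_ v); rewrite -/(qform _ v) qformDZ.
have : 0 <= qform B v by exact: psdB.
move: (qform A v) (qform B v) QAB => [a1 a2] [b1 b2] QAB.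
rewrite lecE /= => /andP[/eqP b2_0 b1_ge0].
have {}QAB p : 0 < p -> a2 == 0 /\ 0 <= a1 + p * b1.
  by move=> /QAB; rewrite b2_0 lecE /= !mulr0 !mul0r subr0 !addr0 => /andP.
have [/eqP-> _] := QAB 1 ltr01.
rewrite lecE /= eqxx /=; apply/ler_addgt0Pr => e e0.
have b1_gt0 : 0 < b1 + 1 by rewrite ltr_wpDl.
(* This choice of [p] gives [p * b1 <= e], even when [b1 = 0]. *)
have [_ /le_trans] := QAB (e / (b1 + 1)) (divr_gt0 e0 b1_gt0); apply.
rewrite lerD2l -mulrA mulrC ger_pMl// mulrC ler_pdivrMr// mul1r lerDl.
exact: ler01.
Qed.

(** Completing the square,
    [p * form(x, y) = |p x + b y|^2 + (p q - |b|^2) |y|^2], settles one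
    direction when [0 < p]; the test vectors in the other direction are the
    columns of the adjugate matrix, which return the determinant times a
    diagonal entry. *)
Lemma psd2P {A : 'M[R[i]]_2} {p q b} :
    A 0 0 = p%:C%C -> A 1 1 = q%:C%C -> A 0 1 = b -> A 1 0 = b^* ->
  psd A <-> [/\ 0 <= p, 0 <= q & normc b ^+ 2 <= p * q].
Proof.
move=> A00 A11 A01 A10.
have bb := mul_conjC_normc b.
have formE (v : 'cV[R[i]]_2) : qform A v =
    p%:C%C * (v 0 0 * (v 0 0)^*) + q%:C%C * (v 1 0 * (v 1 0)^*)
    + b * ((v 0 0)^* * v 1 0) + b^* * ((v 1 0)^* * v 0 0).
  rewrite /qform mxE !big_ord_recl big_ord0 !mxE !big_ord_recl !big_ord0 !mxE.
  have -> : lift ord0 ord0 = 1 :> 'I_2 by apply: val_inj.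
  by rewrite A00 A01 A10 A11; ring.
split=> [psdA|[p0 q0 pq] v].
  pose form x y : R[i] := p%:C%C * (x * x^*) + q%:C%C * (y * y^*)
     + b * (x^* * y) + b^* * (y^* * x).
  have form_ge0 x y : 0 <= form x y.
    have := psdA (\col_i (if i == 0 then x else y)).
    by rewrite -/(qform _ _) formE !mxE.
  have p0 : 0 <= p.
    have := form_ge0 1 0; rewrite /form rmorph1 rmorph0.
    by rewrite !(mulr0, mul0r, mulr1, addr0) ler0c.
  have q0 : 0 <= q.
    have := form_ge0 0 1; rewrite /form rmorph1 rmorph0.
    by rewrite !(mulr0, mul0r, mulr1, addr0, add0r) ler0c.
  have detp : 0 <= p * (p * q - normc b ^+ 2).
    have := form_ge0 (- b) p%:C%C; rewrite /form rmorphN/= conjC_real.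
    rewrite -ler0c rmorphM rmorphB rmorphM/= -bb => /le_trans; apply.
    by rewrite le_eqVlt; apply/orP; left; apply/eqP; ring.
  have detq : 0 <= q * (p * q - normc b ^+ 2).
    have := form_ge0 q%:C%C (- b^*); rewrite /form rmorphN/= conjC_real conjCK.
    rewrite -ler0c rmorphM rmorphB rmorphM/= -bb => /le_trans; apply.
    by rewrite le_eqVlt; apply/orP; left; apply/eqP; ring.
  split=> //; rewrite -subr_ge0.
  move: p0; rewrite le_eqVlt => /orP[/eqP p0|p0]; last first.
    by rewrite -(pmulr_rge0 _ p0).
  move: q0; rewrite le_eqVlt => /orP[/eqP q0|q0]; last first.
    by rewrite -(pmulr_rge0 _ q0).
  (* The diagonal vanishes here, so the adjugate gives no information and the
     off-diagonal entry is tested directly. *)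
  have := form_ge0 (- b) 1; rewrite /form -p0 -q0 rmorphN rmorph1 /=.
  have -> : 0%:C%C * (- b * - b^*) + 0%:C%C * (1 * 1) + b * (- b^* * 1) +
      b^* * (1 * - b) = (- (normc b ^+ 2) * 2)%:C%C.
    by rewrite rmorphM rmorphN rmorph_nat /= -bb; simpc; ring.
  by rewrite ler0c; lra.
rewrite -/(qform A v) formE; move: (v 0 0) (v 1 0) => x y.
move: p0; rewrite le_eqVlt => /orP[/eqP p0|p0].
  have b0 : b = 0.
    apply: eq0_normc; apply/eqP; rewrite -sqrf_eq0 eq_le sqr_ge0 andbT.
    by rewrite (le_trans pq)// -p0 mul0r.
  rewrite b0 -p0 conjC0 !mul0r !addr0 add0r mulr_ge0 ?ler0c//.
  by rewrite mul_conjC_ge0.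
have pC0 : 0 < p%:C%C :> R[i] by rewrite ltcR.
rewrite -(pmulr_rge0 _ pC0).
suff -> : p%:C%C * (p%:C%C * (x * x^*) + q%:C%C * (y * y^*) + b * (x^* * y) +
    b^* * (y^* * x)) = (p%:C%C * x + b * y) * (p%:C%C * x + b * y)^*
    + (p * q - normc b ^+ 2)%:C%C * (y * y^*).
  rewrite addr_ge0 ?mul_conjC_ge0//; apply: mulr_ge0; rewrite ?mul_conjC_ge0//.
  by rewrite ler0c subr_ge0.
rewrite rmorphB rmorphM /= -bb rmorphD !rmorphM /= conjC_real; ring.
Qed.

End PositiveSemidefinite.

(** * Reproducing kernels and the two-point Pick matrices *)

Section ReproducingKernel.
Context {R : realType} {X : Type} {H : rkhs R X} {K : X -> X -> R[i]}.
Hypothesis HK : reproducing_kernel H K.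

Lemma reproducing_kernel_dot :
  exists k : X -> H, forall z w, K z w = rkhs_dot H (k w) (k z).
Proof.
have [k kP] := choice HK.
by exists k => z w; rewrite (kP z).2 (kP w).1.
Qed.

Lemma reproducing_kernel_conj z w : K w z = (K z w)^*.
Proof.
have [k KE] := reproducing_kernel_dot.
by rewrite !KE hermC expr0 mul1r.
Qed.

(** The quadratic form at [v] is the squared norm of the combination, with
    coefficients [v], of the kernel functions at the points [x i]. *)
Lemma reproducing_kernel_psd {n} (x : 'I_n -> X) :
  psd (\matrix_(i, j) K (x i) (x j)).
Proof.
have [k KE] := reproducing_kernel_dot => v; rewrite -/(qform _ v).
suff -> : qform (\matrix_(i, j) K (x i) (x j)) v =
    rkhs_dot H (\sum_j v j 0 *: k (x j)) (\sum_i v i 0 *: k (x i)).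
  exact: dnorm_ge0.
rewrite /qform mxE linear_sumlz; apply: eq_bigr => j _.
rewrite linear_sumr mxE mulr_suml; apply: eq_bigr => i _.
by rewrite [in RHS]linearZl_LR [in RHS]linearZr_LR !mxE KE /= mulrC.
Qed.

Lemma reproducing_kernel_diag z : K z z = (complex.Re (K z z))%:C%C.
Proof.
have [k KE] := reproducing_kernel_dot.
by rewrite RRe_real// KE ger0_real// dnorm_ge0.
Qed.

Hypothesis K_neq0 : non_vanishing K.

Lemma reproducing_kernel_diag_gt0 z : 0 < complex.Re (K z z).
Proof.
have [k KE] := reproducing_kernel_dot.
rewrite -ltcR -reproducing_kernel_diag lt_def K_neq0 KE; exact: dnorm_ge0.
Qed.

Definition pair_fun (z w : X) : 'I_2 -> X := fun i => if i == 0 then z else w.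

(** The determinant condition for the two-point Gram matrix. *)
Lemma kernel_cauchy_schwarz z w :
  normc (K z w) ^+ 2 <= complex.Re (K z z) * complex.Re (K w w).
Proof.
have gram_psd := reproducing_kernel_psd (pair_fun z w).
pose G : 'M[R[i]]_2 := \matrix_(i, j) K (pair_fun z w i) (pair_fun z w j).
have G00 : G 0 0 = (complex.Re (K z z))%:C%C.
  by rewrite mxE; exact: reproducing_kernel_diag.
have G11 : G 1 1 = (complex.Re (K w w))%:C%C.
  by rewrite mxE; exact: reproducing_kernel_diag.
have G01 : G 0 1 = K z w by rewrite mxE.
have G10 : G 1 0 = (K z w)^* by rewrite mxE; exact: reproducing_kernel_conj.
by have [] := iffLR (psd2P G00 G11 G01 G10) gram_psd.
Qed.

Variable phi : X -> R[i].

(** The parameter [t] stands for [C ^+ 2], so that the dependence on it is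
    affine. *)
Definition pick_mx (t : R) (x : 'I_2 -> X) : 'M[R[i]]_2 :=
  \matrix_(i, j)
    (K (x i) (x j) * (real_complex R t - phi (x i) * Num.conj (phi (x j)))).

Lemma pick_mxD s t x :
  pick_mx (s + t) x = pick_mx s x + t%:C%C *: \matrix_(i, j) K (x i) (x j).
Proof. by apply/matrixP => i j; rewrite !mxE rmorphD /=; ring. Qed.

(** As the norm is an infimum, the bound [1] on it by itself only
    gives admissible constants below [Num.sqrt (1 + e)] for each [0 < e];
    adding a multiple of the Gram matrix raises them to exactly level [1 + e],
    where [psd_limit] applies. *)
Lemma mult_norm2_le1P :
  (mult_norm2 K phi <= 1%:E)%E <-> forall x, psd (pick_mx 1 x).
Proof.
split=> [norm_le1 x|psd1]; last first.
  apply: ereal_inf_lbound; exists 1; last by [].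
  by split=> [|x]; [exact: ler01|rewrite expr1n; exact: psd1].
apply: psd_limit (reproducing_kernel_psd x) => e e0.
have sqrt_gt1 : (mult_norm2 K phi < (Num.sqrt (1 + e))%:E)%E.
  apply: le_lt_trans norm_le1 _.
  by rewrite lte_fin -[ltLHS]sqrtr1 ltr_sqrt ?ltrDl// ltr_wpDl.
have [_ [C [C0 psdC] <-]] := ereal_inf_lt sqrt_gt1.
rewrite lte_fin => C_lt.
rewrite -pick_mxD -(subrK (C ^+ 2) (1 + e)) addrC pick_mxD.
apply: psd_add_scale; last exact: reproducing_kernel_psd.
  have e1 : 0 <= 1 + e by rewrite addr_ge0// ltW.
  rewrite subr_ge0 -[leRHS](sqr_sqrtr e1) ler_sqr ?nnegrE ?sqrtr_ge0//.
  exact: ltW.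
exact: psdC.
Qed.

(** Positivity of [pick_mx 1] at [z], [w] in scalar form: the diagonal entries
    are divided by the positive numbers [K z z] and [K w w], whereas the
    determinant inequality keeps them. *)
Definition pick_condition z w : Prop :=
  [/\ normc (phi z) <= 1, normc (phi w) <= 1 &
      normc (K z w) ^+ 2 * normc (1 - (phi w)^* * phi z) ^+ 2 <=
      complex.Re (K z z) * complex.Re (K w w) *
      ((1 - normc (phi z) ^+ 2) * (1 - normc (phi w) ^+ 2))].

Lemma pick_psdP x : psd (pick_mx 1 x) <-> pick_condition (x 0) (x 1).
Proof.
have diag i : pick_mx 1 x i i =
    (complex.Re (K (x i) (x i)) * (1 - normc (phi (x i)) ^+ 2))%:C%C.
  rewrite mxE rmorphM rmorphB /= -mul_conjC_normc -reproducing_kernel_diag.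
  by [].
have offdiag : pick_mx 1 x 1 0 = (pick_mx 1 x 0 1)^*.
  rewrite !mxE rmorphM rmorphB rmorphM /= conjC_real conjCK.
  by rewrite reproducing_kernel_conj; ring.
rewrite (psd2P (diag 0) (diag 1) erefl offdiag) /pick_condition.
have K0 := reproducing_kernel_diag_gt0.
have le1 z : (0 <= complex.Re (K z z) * (1 - normc (phi z) ^+ 2))
    = (normc (phi z) <= 1).
  by rewrite pmulr_rge0// subr_ge0 expr_le1// normc_ge0.
rewrite !le1 mxE normcM exprMn (mulrC (phi _)).
rewrite (mulrACA (complex.Re _)); exact: iff_refl.
Qed.

(** Inside the disc [disc_identity] shows in particular that the denominator
    [1 - b^* a] does not vanish, and Cauchy-Schwarz that the radicand of
    [kernel_dist] is nonnegative; squaring and clearing denominators are then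
    equivalences. *)
Lemma kernel_dist_pick z w : normc (phi z) < 1 -> normc (phi w) < 1 ->
  pseudohyp_dist (phi z) (phi w) <= kernel_dist K z w <-> pick_condition z w.
Proof.
move=> z1 w1; rewrite /pseudohyp_dist /kernel_dist /pick_condition.
rewrite normcM normcV.
have := disc_identity (phi z) (phi w).
have := kernel_cauchy_schwarz z w.
have := mulr_gt0 (reproducing_kernel_diag_gt0 z) (reproducing_kernel_diag_gt0 w).
have n0 := normc_ge0 (phi z - phi w).
have d0 := normc_ge0 (1 - (phi w)^* * phi z).
have m0 : 0 < (1 - normc (phi z) ^+ 2) * (1 - normc (phi w) ^+ 2).
  by rewrite mulr_gt0// subr_gt0 expr_lt1// normc_ge0.
move: (normc (phi z - _)) (normc (1 - _)) (_ * complex.Re _) (normc (K z w) ^+ 2)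
  (_ * (1 - _)) n0 d0 m0 => n d P k m n0 d0 m0 P0 kP nE.
have {}d0 : 0 < d.
  rewrite lt_def d0 andbT; apply: contraTneq m0 => d_eq0.
  rewrite d_eq0 in nE; have := sqr_ge0 n; rewrite -leNgt nE; lra.
have s0 : 0 <= 1 - k / P by rewrite subr_ge0 ler_pdivrMr// mul1r.
have -> : (n / d <= Num.sqrt (1 - k / P)) = (k * d ^+ 2 <= P * m).
  rewrite -ler_sqr ?nnegrE ?sqrtr_ge0 ?divr_ge0 ?(ltW d0)// sqr_sqrtr// expr_div_n.
  rewrite nE ler_pdivrMr ?exprn_gt0// mulrBl mul1r lerD2l lerN2.
  by rewrite mulrAC ler_pdivrMr// [m * _]mulrC.
by split=> [le_kd|[_ _ le_kd]] //; split=> //; exact: ltW.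
Qed.

End ReproducingKernel.

Theorem proposition2p1 (R : realType) (X : Type) (X_nonempty : inhabited X)
    (H : rkhs R X) (K : X -> X -> R[i])
    (HK : reproducing_kernel H K) (K_neq0 : non_vanishing K)
    (phi : X -> R[i]) :
  (mult_norm2 K phi <= 1%:E)%E <->
  ((exists c : R[i], normc c <= 1 /\ forall x : X, phi x = c) \/
   ((forall x : X, unit_disc (phi x)) /\
    (forall z w : X,
       pseudohyp_dist (phi z) (phi w) <= kernel_dist K z w))).
Proof.
rewrite (mult_norm2_le1P HK).
have pickP x : psd (pick_mx (K := K) phi 1 x) <->
    pick_condition (K := K) phi (x 0) (x 1).
  exact: pick_psdP HK K_neq0 phi x.
split=> [psd1|[[c [c1 phic]]|[disc contr]] x]; last 2 first.
- apply/pickP; split; rewrite ?phic//.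
  rewrite (mulrC c^*) mul_conjC_normc.
  have -> : 1 - (normc c ^+ 2)%:C%C = (1 - normc c ^+ 2)%:C%C.
    by rewrite rmorphB.
  rewrite [normc _%:C%C]/= expr0n addr0 sqrtr_sqr real_normK ?num_real//.
  rewrite -expr2 ler_wpM2r ?sqr_ge0//; exact: kernel_cauchy_schwarz.
- by apply/pickP/(kernel_dist_pick HK K_neq0); [exact: disc..|exact: contr].
have pick z w : pick_condition (K := K) phi z w.
  exact: (pickP (pair_fun z w)).1.
have [[z z1]|no_unimodular] := pselect (exists z, normc (phi z) = 1).
  left; exists (phi z); split=> [|w]; first by rewrite z1.
  apply: normc_conj_eq => //.
  have [_ _] := pick z w; rewrite z1 expr1n subrr mul0r mulr0 -exprMn -normcM => le0.
  have /eq0_normc/eqP : normc (K z w * (1 - (phi w)^* * phi z)) = 0.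
    by apply/eqP; rewrite -sqrf_eq0 eq_le le0 sqr_ge0.
  by rewrite mulf_eq0 (negPf (K_neq0 z w)) subr_eq0 mulrC => /eqP.
right.
have disc z : normc (phi z) < 1.
  have [z1 _ _] := pick z z; rewrite lt_neqAle z1 andbT; apply/eqP => z_eq1.
  by apply: no_unimodular; exists z.
split=> // z w; exact/(kernel_dist_pick HK K_neq0).
Qed.
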